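(* Let $n\ge1$ and let $\mathrm{Fl} = \{\mathrm{fl}_1,\dots,\mathrm{fl}_n\}$ be a tuple of functions which round to nearest in an unperfect floating point system with unit roundoff $u$. If $y_0,\dots,y_n\in\mathbb{R}$ and $20 n u\leq 1$, then $$\left| \mathrm{Fl}\left(\sum_{k=0}^n y_k\right) - \sum_{k=0}^n y_k\right| \leq \frac{n\alpha}{2} + \frac{nu}{1+nu}\left(\frac{n\alpha}{2}+\sum_{k=0}^n |y_k|\right).$$ If, additionally, $u\sum_{k=0}^n|y_k|\ge\alpha$, then $$\left| \mathrm{Fl}\left(\sum_{k=0}^n y_k\right) - \sum_{k=0}^n y_k\right| \leq \frac{nu}{1+nu}\sum_{k=0}^n |y_k|.$$
   Context: Let $\beta \ge 2$ be an integer (the base) and $\mu \ge 1$ an integer. The unit roundoff is $u := 1/(2\beta^{\mu})$. For $e\in\mathbb{Z}$ let $\mathcal{E}_e := \{\beta^e(\beta^\mu + r) : r = 0,1,\dots,(\beta-1)\beta^\mu - 1\}$. Let $e_\alpha < -\mu$ be an integer. The MPFR system associated to $\beta,\mu,e_\alpha$ is $\mathcal{M} := \{0\}\cup\bigcup_{e\ge e_\alpha} (\mathcal{E}_e \cup -\mathcal{E}_e)$. With $\mathcal{S}_{e_\alpha} := \{\beta^{e_\alpha} r : r = 1,\dots,\beta^\mu-1\}$, the IEEE system is $\mathcal{I} := \mathcal{M}\cup \mathcal{S}_{e_\alpha}\cup -\mathcal{S}_{e_\alpha}$. An unperfect system is an IEEE system or an MPFR system. The number $\alpha$ is $\beta^{e_\alpha}$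 for the IEEE system and $\beta^{e_\alpha+\mu}$ for the MPFR system. A function $\mathrm{fl}:\mathbb{R}\to\mathbb{R}$ rounds to nearest in a system $\mathcal{F}$ if for all $z\in\mathbb{R}$ one has $\mathrm{fl}(z)\in\mathcal{F}$ and $|\mathrm{fl}(z)-z|\le|x-z|$ for all $x\in\mathcal{F}$ (ties may be broken arbitrarily). A tuple $\mathrm{Fl}=\{\mathrm{fl}_1,\dots,\mathrm{fl}_n\}$ rounds to nearest in $\mathcal{F}$ if each $\mathrm{fl}_k$ does (the $\mathrm{fl}_k$ may differ). Floating point sum: for real $y_0,\dots,y_n$, put $\hat s_1 := \mathrm{fl}_1(y_0+y_1)$ and $\hat s_k := \mathrm{fl}_k(\hat s_{k-1}+y_k)$ for $2\le k\le n$. Then $\mathrm{Fl}\left(\sum_{k=0}^n y_k\right) := \hat s_n$. *)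

(* Defs.v *)
From mathcomp Require Import all_boot all_order all_algebra.
From mathcomp Require Import classical_sets reals.

Set Implicit Arguments.
Unset Strict Implicit.
Unset Printing Implicit Defensive.

Import Order.TTheory GRing.Theory Num.Theory.

Local Open Scope classical_set_scope.
Local Open Scope ring_scope.

Section FloatingPointSystems.
Variables (R : realType) (beta mu : nat).

Definition unit_roundoff : R := (2 * beta%:R ^+ mu)^-1.

(* The numbers [beta ^ e * m] with [beta ^ mu <= m < beta ^ mu.+1]. *)
Definition normal_range (e : int) : set R :=
  [set beta%:R ^ e * (beta ^ mu + r)%:R
    | r in [set r : nat | (r < beta.-1 * beta ^ mu)%N]].

Definition subnormals (e : int) : set R :=
  [set beta%:R ^ e * r%:R | r in [set r : nat | (1 <= r < beta ^ mu)%N]].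

Definition opp_set (A : set R) : set R := [set - x | x in A].

Definition mpfr_system (ealpha : int) : set R :=
  [set 0] `|` \bigcup_(e in [set e : int | ealpha <= e])
                (normal_range e `|` opp_set (normal_range e)).

Definition ieee_system (ealpha : int) : set R :=
  mpfr_system ealpha `|` subnormals ealpha `|` opp_set (subnormals ealpha).

End FloatingPointSystems.

Variant unperfect_kind := IEEE | MPFR.

Definition unperfect_system (R : realType) (kind : unperfect_kind)
    (beta mu : nat) (ealpha : int) : set R :=
  match kind with
  | IEEE => ieee_system beta mu ealpha
  | MPFR => mpfr_system beta mu ealpha
  end.

(* In both cases this is the smallest positive element of the system. *)
Definition alpha (R : realType) (kind : unperfect_kind)
    (beta mu : nat) (ealpha : int) : R :=
  match kind with
  | IEEE => beta%:R ^ ealpha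
  | MPFR => beta%:R ^ (ealpha + mu%:Z)
  end.

(* Ties may be broken arbitrarily, possibly differently at each point. *)
Definition rounds_to_nearest (R : realType) (F : set R) (fl : R -> R) : Prop :=
  forall z : R, F (fl z) /\ forall x : R, F x -> `|fl z - z| <= `|x - z|.

(* [fl_sum fl y n] is the computed sum of [y 0, ..., y n] with the roundings
   [fl 1, ..., fl n]; the values [fl 0], [fl k] and [y k] for [k > n] are not
   used.  The first addend is not rounded, so the partial sum of index 1 is
   [fl 1 (y 0 + y 1)]. *)
Fixpoint fl_sum (R : realType) (fl : nat -> R -> R) (y : nat -> R) (n : nat)
    : R :=
  match n with
  | 0 => y 0
  | k.+1 => fl k.+1 (fl_sum fl y k + y k.+1)
  end.

(* Main.v *)
Require Import Defs.
From mathcomp Require Import all_boot all_order all_algebra.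
From mathcomp Require Import ring lra zify.
From mathcomp Require Import classical_sets boolp reals.

(** The error of the computed sum is the sum of the errors [d 0, ..., d n.-1] of
    the [n] roundings, so it suffices to bound [D], the sum of their absolute
    values.  Write [T] for the sum of the [|y k|], [u] for the unit roundoff and
    [z k] for the number rounded by the [k]-th rounding.  The target
    [D <= n u / (1 + n u) * T] is equivalent to [D <= n u * (T - D)], and this
    is the form in which the argument becomes transparent.

    A rounding to nearest has an error of at most [alpha / 2], or there is a
    power [p k <= |z k|] of the base, lying in the system, such that the error
    is at most [u * p k] ([rounding_error]).  If the first alternative holds for
    all [k] then [D <= n alpha / 2].  Otherwise, let [P] be the largest of the
    powers [p k] and [q] the first index at which it occurs.  Because [P] and
    [- P] are in the system, [|d q| <= |z q| - P]; and because every partial sum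
    after the first rounding is itself in the system, [|d k| <= |y k.+1|] for
    [k > q].  Since [|z q|] exceeds [|y 0| + ... + |y q.+1|] by at most the
    total error [D_q] of the roundings before [q], all this adds up to
    [P - 2 D_q <= T - D].

    The roundings from [q] on contribute at most [u P] each, and the earlier
    ones at most [u P / 2] each because distinct powers of the base differ by a
    factor of two at least; both up to underflow errors, which are at most
    [alpha / 2].  So, leaving underflow aside, [D <= n u P - q u P / 2] and
    [D_q <= q u P / 2], and the gain [q u P / 2] in the first estimate pays for
    the loss [2 D_q] in the lower bound for [T - D] as soon as [2 n u <= 1].
    [error_profile] collects these facts, and the two bounds of the theorem
    follow from it by real arithmetic: in [absolute_arith] each rounding is
    charged an additional [alpha / 2], while in [relative_arith] the hypothesis
    [alpha <= u T] makes [alpha / 2] hardly larger than [u P / 2] whenever [T] is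
    not already so large that the trivial bound for [D] suffices. *)

Set Implicit Arguments.
Unset Strict Implicit.
Unset Printing Implicit Defensive.

Import Order.TTheory GRing.Theory Num.Theory.

Local Open Scope ring_scope.

(** * Powers of the base and the error of one rounding *)

(** The candidates for the largest power of the base below a given number.  The
    offset [mu] makes each of them the smallest element of a normal range, so
    that they all belong to the systems of both kinds. *)
Definition binade (R : realType) (beta mu : nat) (ealpha : int) (P : R) :=
  exists2 e : int, ealpha <= e & P = beta%:R ^ (e + mu%:Z).

(** Rounding a scaled number to an integer must not leave its normal range: the
    last two conclusions say that the integer obeys every integer bound that the
    number does. *)
Lemma nearest_nat (R : realType) (t : R) : 0 <= t ->
  exists m : nat, [/\ `|m%:R - t| <= 1 / 2,
    forall N : nat, N%:R <= t -> (N <= m)%N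
    & forall N : nat, t <= N%:R -> (m <= N)%N].
Proof.
move=> t0; have t20 : 0 <= t + 1 / 2 by lra.
exists (Num.truncn (t + 1 / 2)); split.
- have := truncn_itv t20; set m := Num.truncn _.
  rewrite -(natr1 m) => /andP[h1 h2].
  by rewrite ler_norml; apply/andP; split; lra.
- by move=> N hN; rewrite truncn_ge_nat //; lra.
- by move=> N hN; rewrite truncn_le_nat -(natr1 N); lra.
Qed.

Section Binades.
Context {R : realType} {beta mu : nat}.
Hypothesis hbeta : (2 <= beta)%N.

Lemma beta_gt1 : 1 < beta%:R :> R.
Proof. by rewrite ltr1n. Qed.

Lemma beta_ge2 : 2 <= beta%:R :> R.
Proof. by rewrite ler_nat. Qed.

Lemma beta_neq0 : beta%:R != 0 :> R.
Proof. by rewrite gt_eqF // (lt_trans ltr01 beta_gt1). Qed.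

Lemma betaz_gt0 (e : int) : 0 < beta%:R ^ e :> R.
Proof. by rewrite exprz_gt0 // (lt_trans ltr01 beta_gt1). Qed.

Lemma betazD (e f : int) : beta%:R ^ (e + f) = beta%:R ^ e * beta%:R ^ f :> R.
Proof. by rewrite expfzDr // beta_neq0. Qed.

Lemma unit_roundoff_gt0 : 0 < unit_roundoff R beta mu.
Proof.
by rewrite invr_gt0 mulr_gt0 // exprn_gt0 // (lt_trans ltr01 beta_gt1).
Qed.

(** Consecutive elements of the normal range of [e] are [beta ^ e] apart; this is
    why errors are measured in units of [u] times a power of the base. *)
Lemma half_spacing (e : int) :
  unit_roundoff R beta mu * beta%:R ^ (e + mu%:Z) = beta%:R ^ e / 2.
Proof.
rewrite /unit_roundoff betazD -exprnP.
by field; rewrite expf_neq0 // beta_neq0.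
Qed.

Lemma binade_gt0 (ealpha : int) (P : R) : binade beta mu ealpha P -> 0 < P.
Proof. by case=> e _ ->; apply: betaz_gt0. Qed.

Lemma binade_gap (ealpha : int) (P Q : R) :
  binade beta mu ealpha P -> binade beta mu ealpha Q -> P < Q -> P <= Q / 2.
Proof.
move=> [e _ ->] [f _ ->]; rewrite ltr_eXz2l ?beta_gt1 // => ef.
have h : beta%:R ^ (1 + (e + mu%:Z)) <= beta%:R ^ (f + mu%:Z) :> R.
  by rewrite ler_eXz2l ?beta_gt1 //; lia.
rewrite (betazD 1) expr1z in h.
have := ler_wpM2r (ltW (betaz_gt0 (e + mu%:Z))) beta_ge2.
lra.
Qed.

Lemma binade_cover (ealpha : int) (z : R) : beta%:R ^ (ealpha + mu%:Z) <= z ->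
  exists2 e : int, ealpha <= e
    & beta%:R ^ (e + mu%:Z) <= z <= beta%:R ^ (e + 1 + mu%:Z).
Proof.
set P := beta%:R ^ _ => Pz.
have P0 : 0 < P by apply: betaz_gt0.
have PE (j : nat) : beta%:R ^ (ealpha + j%:Z + mu%:Z) = P * beta%:R ^+ j.
  by rewrite exprnP -betazD addrAC.
have ex : exists j, z <= P * beta%:R ^+ j.+1.
  (* Any exponent beyond [z / P] will do, since [j < beta ^ j]. *)
  exists (Num.truncn (z / P)).
  rewrite mulrC -ler_pdivrMr //; apply: (le_trans (ltW (truncnS_gt _))).
  rewrite -natrX ler_nat; exact/ltnW/ltn_expl.
case: (ex_minnP ex) => j hj mn.
exists (ealpha + j%:Z); first lia.
have -> : ealpha + j%:Z + 1 + mu%:Z = ealpha + j.+1%:Z + mu%:Z by lia.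
rewrite !PE hj andbT.
case: j mn {hj} => [|j] mn; first by rewrite mulr1.
by rewrite leNgt; apply/negP => /ltW/mn; rewrite ltnn.
Qed.

Lemma mpfr_systemN (ealpha : int) (x : R) :
  mpfr_system beta mu ealpha x -> mpfr_system beta mu ealpha (- x).
Proof.
case=> [->|[e he [nx|[w nw <-]]]]; first by left; rewrite oppr0.
- by right; exists e => //; right; exists x.
- by right; exists e => //; left; rewrite opprK.
Qed.

Lemma unperfect_systemN kind (ealpha : int) (x : R) :
  unperfect_system kind beta mu ealpha x ->
  unperfect_system kind beta mu ealpha (- x).
Proof.
case: kind => /=; last exact: mpfr_systemN.
case=> [[mx|sx]|[w sw <-]]; first by left; left; apply: mpfr_systemN.
- by right; exists x.
- by left; right; rewrite opprK.
Qed.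

Lemma mpfr_system_sub kind (ealpha : int) (x : R) :
  mpfr_system beta mu ealpha x -> unperfect_system kind beta mu ealpha x.
Proof. by case: kind => //= mx; left; left. Qed.

Lemma mpfr_system_normal (ealpha e : int) (m : nat) : ealpha <= e ->
  (beta ^ mu <= m < beta ^ mu.+1)%N ->
  mpfr_system beta mu ealpha (beta%:R ^ e * m%:R : R).
Proof.
move=> he /andP[m1 m2]; right; exists e => //; left.
exists (m - beta ^ mu)%N; last by rewrite subnKC.
by rewrite /= -subn1 mulnBl mul1n ltn_sub2r -?expnS // ltn_exp2l.
Qed.

Lemma binade_in_system kind (ealpha : int) (P : R) :
  binade beta mu ealpha P -> unperfect_system kind beta mu ealpha P.
Proof.
case=> e he ->; apply: mpfr_system_sub.
by rewrite betazD -exprnP -natrX; apply: mpfr_system_normal; rewrite // leqnn ltn_exp2l /=.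
Qed.

(** Above the smallest normal number, [z / beta ^ e] is rounded to an integer,
    with [e] the exponent of [z]; if the integer is [beta ^ mu.+1], the result is
    the first element of the next normal range.  Below, the system has elements
    at all multiples of [alpha], which for the MPFR kind are only [0] and the
    smallest normal number itself. *)
Lemma system_near kind (ealpha : int) (z : R) : 0 <= z ->
  exists2 x, unperfect_system kind beta mu ealpha x &
    `|x - z| <= alpha R kind beta mu ealpha / 2 \/
    exists2 P, binade beta mu ealpha P /\ P <= z
      & `|x - z| <= unit_roundoff R beta mu * P.
Proof.
move=> z0.
have scaled (e : int) (m : nat) : `|m%:R - z / beta%:R ^ e| <= 1 / 2 ->
    `|beta%:R ^ e * m%:R - z| <= beta%:R ^ e / 2.
  have g := betaz_gt0 e.
  have -> : beta%:R ^ e * m%:R - z = beta%:R ^ e * (m%:R - z / beta%:R ^ e).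
    by field; rewrite gt_eqF.
  by rewrite normrM gtr0_norm // ler_pM2l // mul1r.
have quo_ge0 e : 0 <= z / beta%:R ^ e.
  by rewrite divr_ge0 // ltW // betaz_gt0.
have [zP|Pz] := ltP z (beta%:R ^ (ealpha + mu%:Z)); last first.
  have [e he /andP[ez ze]] := binade_cover Pz.
  have [m [near lo hi]] := nearest_nat (quo_ge0 e).
  exists (beta%:R ^ e * m%:R).
    (* The bounds of the binade are integers after scaling, so rounding keeps them. *)
    have m1 : (beta ^ mu <= m)%N.
      by apply: lo; rewrite ler_pdivlMr ?betaz_gt0 // natrX mulrC exprnP -betazD.
    have : (m <= beta ^ mu.+1)%N.
      apply: hi; rewrite ler_pdivrMr ?betaz_gt0 // natrX mulrC exprnP -betazD.
      by have <- : e + 1 + mu%:Z = e + mu.+1%:Z by lia.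
    rewrite leq_eqVlt => /predU1P[->|m2].
      apply: binade_in_system; exists (e + 1); first lia.
      by rewrite natrX exprnP -betazD; congr (_ ^ _); lia.
    by apply/mpfr_system_sub/mpfr_system_normal; rewrite ?m1.
  right; exists (beta%:R ^ (e + mu%:Z)); first by split=> //; exists e.
  by rewrite half_spacing; apply: scaled.
case: kind.
- have [m [near lo hi]] := nearest_nat (quo_ge0 ealpha).
  exists (beta%:R ^ ealpha * m%:R); last by left; apply: scaled.
  have : (m <= beta ^ mu)%N.
    apply: hi; rewrite ler_pdivrMr ?betaz_gt0 // natrX mulrC exprnP -betazD.
    exact: ltW.
  rewrite leq_eqVlt => /predU1P[->|m2].
    apply: binade_in_system; exists ealpha => //.
    by rewrite natrX exprnP -betazD.
  case: m near lo hi m2 => [|m] near lo hi m2.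
    by left; left; left; rewrite mulr0.
  by left; right; exists m.+1.
- have [h|h] := leP z (beta%:R ^ (ealpha + mu%:Z) / 2).
    exists 0; first by left.
    by left; rewrite /= sub0r normrN ger0_norm.
  exists (beta%:R ^ (ealpha + mu%:Z)).
    by apply: (@binade_in_system MPFR); exists ealpha.
  by left; rewrite /= ger0_norm; lra.
Qed.

Lemma rounding_error kind (ealpha : int) (fl : R -> R) (z : R) :
  rounds_to_nearest (unperfect_system kind beta mu ealpha) fl ->
  `|fl z - z| <= alpha R kind beta mu ealpha / 2 \/
  exists2 P, binade beta mu ealpha P /\ P <= `|z|
    & `|fl z - z| <= unit_roundoff R beta mu * P.
Proof.
move=> hfl; have [x Fx nx] := system_near kind ealpha (normr_ge0 z).
have : `|fl z - z| <= `|x - `|z| |.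
  have [z0|z0] := ger0P z; first by apply: (hfl z).2.
  have -> : `|x - - z| = `|- x - z| by rewrite -normrN; congr `|_|; ring.
  by apply: (hfl z).2; apply: unperfect_systemN.
move=> le; case: nx => [h|[P hP h]]; [left|right; exists P => //]; exact: le_trans h.
Qed.

(** A rounding never crosses an element of the system; applied to [P] or [- P],
    whichever lies on the side of [z], this makes the error small when [`|z|]
    barely exceeds a power of the base. *)
Lemma rounding_error_binade kind (ealpha : int) (fl : R -> R) (z P : R) :
  rounds_to_nearest (unperfect_system kind beta mu ealpha) fl ->
  binade beta mu ealpha P -> P <= `|z| -> `|fl z - z| <= `|z| - P.
Proof.
move=> hfl hP; have FP := binade_in_system kind hP.
have [z0|z0] := ger0P z => Pz.
  by apply: (le_trans ((hfl z).2 _ FP)); rewrite ler0_norm; lra.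
apply: (le_trans ((hfl z).2 _ (unperfect_systemN FP))).
by rewrite ger0_norm; lra.
Qed.

End Binades.

(** * Accumulation of the rounding errors *)

Lemma first_argmax (R : realType) (p : nat -> R) (n : nat) :
  exists q, [/\ (q <= n)%N, forall i, (i <= n)%N -> p i <= p q
                & forall i, (i < q)%N -> p i < p q].
Proof.
elim: n => [|n [q [qn mx st]]].
  by exists 0%N; split => // i; rewrite leqn0 => /eqP->.
have [h|h] := leP (p n.+1) (p q).
  exists q; split=> // [|i]; first exact: leqW.
  by rewrite leq_eqVlt => /predU1P[->//|]; rewrite ltnS; apply: mx.
exists n.+1; split=> // i; last by rewrite ltnS => /mx/le_lt_trans; apply.
by rewrite leq_eqVlt => /predU1P[->//|]; rewrite ltnS => /mx/le_trans->//; apply: ltW.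
Qed.

Definition local_error (R : realType) (fl : nat -> R -> R) (y : nat -> R) k :=
  fl_sum fl y k.+1 - (fl_sum fl y k + y k.+1).

Lemma fl_sum_error (R : realType) (fl : nat -> R -> R) (y : nat -> R) n :
  fl_sum fl y n
  = \sum_(0 <= k < n.+1) y k + \sum_(0 <= k < n) local_error fl y k.
Proof.
elim: n => [|n IH]; first by rewrite big_nat1 big_geq ?addr0.
rewrite big_nat_recr //= [X in _ = _ + X]big_nat_recr //= /local_error /= IH.
ring.
Qed.

Lemma sum_le_const (R : realType) (f : nat -> R) (m n : nat) (c : R) :
  (m <= n)%N -> (forall i, (m <= i < n)%N -> f i <= c) ->
  \sum_(m <= i < n) f i <= (n%:R - m%:R) * c.
Proof.
move=> mn h; apply: (le_trans (ler_sum_nat h)).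
by rewrite sumr_const_nat -natrB // mulr_natl.
Qed.

Section ErrorProfile.
Context {R : realType} {beta mu : nat} {ealpha : int} {kind : unperfect_kind}.
Context {fl : nat -> R -> R} {y : nat -> R} {n : nat}.
Hypothesis hbeta : (2 <= beta)%N.
Hypothesis hfl : forall k : nat, (1 <= k <= n)%N ->
  rounds_to_nearest (unperfect_system kind beta mu ealpha) (fl k).

Let u := unit_roundoff R beta mu.
Let a := alpha R kind beta mu ealpha.
Let d k := `|local_error fl y k|.
Let D m := \sum_(0 <= k < m) d k.
Let T m := \sum_(0 <= k < m) `|y k|.

Lemma alpha_ge0 : 0 <= a.
Proof. by rewrite /a; case: kind => /=; apply/ltW/betaz_gt0. Qed.

Lemma fl_sum_error_le m : `|fl_sum fl y m - \sum_(0 <= k < m.+1) y k| <= D m.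
Proof. by rewrite fl_sum_error addrC addKr ler_norm_sum. Qed.

Lemma rounded_le k : `|fl_sum fl y k + y k.+1| <= T k.+2 + D k.
Proof.
rewrite fl_sum_error addrAC -big_nat_recr //=.
by apply: (le_trans (ler_normD _ _)); rewrite lerD // ler_norm_sum.
Qed.

(** The partial sum before the addition is a competitor for the rounded result.
    It is in the system only if it is itself the output of a rounding, whence
    [0 < k]: the first addend is an arbitrary real number. *)
Lemma local_error_le_addend k : (0 < k < n)%N -> d k <= `|y k.+1|.
Proof.
move=> /andP[k0 kn]; have ks : (1 <= k.+1 <= n)%N by [].
case: k k0 kn ks => // k _ kn ks.
have hk : (1 <= k.+1 <= n)%N by rewrite /= ltnW.
have [Fs _] := hfl hk (fl_sum fl y k + y k.+1).
have [_ near] := hfl ks (fl_sum fl y k.+1 + y k.+2).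
apply: (le_trans (near _ Fs)).
by rewrite opprD addrA subrr sub0r normrN.
Qed.

(** The rounding [q] costs at most [`|z q| - P], and [`|z q|] is at most
    [T q.+2 + D q]; this gives the inequality for [m = q.+1].  Each later rounding
    increases [T] at least as much as [D]. *)
Lemma sub_error_ge q m (P : R) : (q < m <= n)%N ->
  binade beta mu ealpha P -> P <= `|fl_sum fl y q + y q.+1| ->
  P - 2 * D q <= T m.+1 - D m.
Proof.
have DS k : D k.+1 = D k + d k by rewrite /D big_nat_recr.
have TS k : T k.+1 = T k + `|y k| by rewrite /T big_nat_recr.
move=> /andP[qm mn] hP Pz; elim: m qm mn => // m IH; rewrite ltnS => qm mn.
have [qm'|mq] := ltnP q m.
  have m0 : (0 < m < n)%N by rewrite (leq_ltn_trans _ qm').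
  have := IH qm' (ltnW mn); have := local_error_le_addend m0.
  by rewrite (TS m.+1) (DS m); lra.
have {mq}-> : m = q by apply/eqP; rewrite eqn_leq mq qm.
have qs : (1 <= q.+1 <= n)%N by rewrite /= (leq_ltn_trans qm).
have := rounding_error_binade hbeta (hfl qs) hP Pz.
rewrite -/(local_error fl y q) -/(d q).
by have := rounded_le q; rewrite (DS q); lra.
Qed.

(** [P] is the largest scale that governs a rounding error, and [q] is the first
    rounding governed by it.  The maxima with [a / 2] account for the roundings
    that underflow. *)
Lemma error_profile :
  D n <= n%:R * (a / 2) \/
  exists q P, [/\ (q <= n)%N, 0 < P,
    D q <= q%:R * Num.max (u * P / 2) (a / 2),
    D n <= D q + (n%:R - q%:R) * Num.max (u * P) (a / 2)
    & P - 2 * D q <= T n.+1 - D n].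
Proof.
have u0 : 0 < u by apply: unit_roundoff_gt0.
have a0 := alpha_ge0.
have scale_ex k : exists p, (k < n)%N ->
    d k <= Num.max (u * p) (a / 2)
    /\ (p = 0 \/ binade beta mu ealpha p /\ p <= `|fl_sum fl y k + y k.+1|).
  (* The scale [0] encodes an error explained by underflow alone. *)
  have [kn|nk] := ltnP k n; last by exists 0.
  have ks : (1 <= k.+1 <= n)%N by [].
  have [h|[P hP h]] :=
    rounding_error hbeta (fl_sum fl y k + y k.+1) (hfl ks).
    by exists 0 => _; split; [rewrite le_max h orbT|left].
  by exists P => _; split; [rewrite le_max h|right].
have [p hp] := choice scale_ex.
have sum0 : n = 0%N -> D n <= n%:R * (a / 2).
  by move=> ->; rewrite /D big_geq // mul0r.
have [/sum0|n0] := posnP n; first by left.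
have [q [qn pmax pfirst]] := first_argmax p n.-1.
have {}qn : (q < n)%N by rewrite -(prednK n0) ltnS.
have {}pmax k : (k < n)%N -> p k <= p q.
  by move=> kn; apply: pmax; rewrite -ltnS prednK.
have [_ [pq0|[hP Pz]]] := hp _ qn.
  left; rewrite -[n%:R]subr0; apply: sum_le_const => // k /= kn.
  apply: (le_trans (hp k kn).1); rewrite ge_max lexx andbT.
  have : u * p k <= 0 by rewrite pmulr_rle0 // -pq0 pmax.
  lra.
have P0 := binade_gt0 hbeta hP.
right; exists q, (p q); split=> //; first exact: ltnW.
- rewrite -[q%:R]subr0; apply: sum_le_const => // k /= kq.
  have [dk scale] := hp k (ltn_trans kq qn).
  apply: (le_trans dk); rewrite ge_max !le_max lexx orbT andbT.
  apply/orP; left; rewrite -mulrA ler_pM2l //.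
  case: scale => [->|[hk _]]; first lra.
  exact: (binade_gap hbeta hk hP (pfirst _ kq)).
- rewrite /D (big_cat_nat (n := q)) //=; last exact: ltnW.
  rewrite lerD2l; apply: sum_le_const => [|k /andP[_ kn]]; first exact: ltnW.
  apply: (le_trans (hp k kn).1); rewrite ge_max !le_max lexx orbT andbT.
  by rewrite ler_pM2l // pmax.
- by apply: sub_error_ge; rewrite // qn leqnn.
Qed.

End ErrorProfile.

(** * The two bounds as real inequalities *)

(** With [v = n u], the quotient in the theorem is the solution of a linear
    inequality in which the total error [D] occurs on both sides. *)
Lemma nu_quotient_le (R : realType) (v D T : R) :
  0 <= v -> D <= v * (T - D) -> D <= v / (1 + v) * T.
Proof.
move=> v0 h; rewrite mulrAC ler_pdivlMr; last by lra.
nra.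
Qed.

(** Once the denominator is cleared, the two terms [n a / 2] together amount to
    [(1 + 2 n u) n a / 2] and absorb all contributions of underflow; what remains
    is [(1 + 2 n u) * (q u P / 2) <= q u P]. *)
Lemma absolute_arith (R : realType) (n q u a P D Dq T : R) :
  0 <= q <= n -> 0 <= u -> 0 <= a -> 0 <= P -> 2 * (n * u) <= 1 ->
  Dq <= q * Num.max (u * P / 2) (a / 2) ->
  D <= Dq + (n - q) * Num.max (u * P) (a / 2) ->
  P - 2 * Dq <= T - D ->
  D <= n * a / 2 + n * u / (1 + n * u) * (n * a / 2 + T).
Proof.
move=> /andP[q0 qn] u0 a0 P0 nu hqmax hDmax hT.
have nu0 : 0 <= n * u by rewrite mulr_ge0 //; lra.
have uP0 : 0 <= u * P by rewrite mulr_ge0.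
have max_le_add (x : R) : 0 <= x -> Num.max x (a / 2) <= x + a / 2.
  by move=> x0; rewrite ge_max; apply/andP; split; lra.
have hq : Dq <= q * (u * P / 2 + a / 2).
  by apply: (le_trans hqmax); rewrite ler_wpM2l // max_le_add //; lra.
have hD : D <= Dq + (n - q) * (u * P + a / 2).
  by apply: (le_trans hDmax); rewrite lerD2l ler_wpM2l ?subr_ge0 // max_le_add.
suff : D - n * a / 2 <= n * u / (1 + n * u) * (n * a / 2 + T) by lra.
apply: nu_quotient_le => //.
have qa : 0 <= q * a by exact: mulr_ge0.
have quP : 0 <= q * (u * P) by rewrite !mulr_ge0.
have h1 : (1 + 2 * (n * u)) * Dq <= (1 + 2 * (n * u)) * (q * (u * P / 2 + a / 2)).
  by rewrite ler_wpM2l //; lra.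
have h2 : n * u * (P - 2 * Dq) <= n * u * (T - D) by rewrite ler_wpM2l.
have h3 : 2 * (n * u) * (q * (u * P)) <= q * (u * P) by rewrite -[leRHS]mul1r ler_wpM2r.
have h4 : n * u * (q * a) <= n * u * (n * a) by rewrite ler_wpM2l // ler_wpM2r.
lra.
Qed.

(** The trivial bound [D <= n c], with [c] the larger of [u P] and [a / 2],
    suffices when [(1 + n u) c <= u T].  Otherwise [a <= u T] forces [c = u P]
    and [a <= (1 + n u) u P], so that the roundings before [q] cost at most
    [(1 + n u) u P / 2] each, and the estimate without underflow goes through
    because [(1 + 2 n u) (1 + n u) <= 2]. *)
Lemma relative_arith (R : realType) (n q u a P D Dq T : R) :
  0 <= q <= n -> 0 < u -> 0 <= a -> 0 <= P -> 20 * (n * u) <= 1 ->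
  Dq <= q * Num.max (u * P / 2) (a / 2) ->
  D <= Dq + (n - q) * Num.max (u * P) (a / 2) ->
  P - 2 * Dq <= T - D ->
  a <= u * T ->
  D <= n * u / (1 + n * u) * T.
Proof.
move=> /andP[q0 qn] u0 a0 P0 nu hq hD hT haT.
have nu0 : 0 <= n * u by rewrite mulr_ge0 //; lra.
have T0 : 0 <= T.
  by rewrite -(pmulr_rge0 _ u0); lra.
apply: nu_quotient_le => //.
set c := Num.max (u * P) (a / 2) in hD.
have c0 : 0 <= c by rewrite le_max; apply/orP; right; lra.
have Dc : D <= n * c.
  have : q * Num.max (u * P / 2) (a / 2) <= q * c.
    apply: ler_wpM2l => //; rewrite ge_max !le_max lexx orbT andbT.
    have uP0 : 0 <= u * P by rewrite mulr_ge0 // ltW.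
    by apply/orP; left; lra.
  lra.
have [big|small] := leP ((1 + n * u) * c) (u * T).
  have h : n * ((1 + n * u) * c) <= n * (u * T) by rewrite ler_wpM2l //; lra.
  have h2 : n * u * D <= n * u * (n * c) by rewrite ler_wpM2l.
  lra.
have cE : c = u * P.
  rewrite /c; case: (leP (u * P) (a / 2)) => // hc.
  move: small; rewrite /c (max_r hc) => small.
  have : n * u * a <= 1 * a by rewrite ler_wpM2r //; lra.
  lra.
have mE : Num.max (u * P / 2) (a / 2) <= (1 + n * u) * (u * P) / 2.
  have uP0 : 0 <= u * P by rewrite -cE.
  have : 0 <= n * u * (u * P) by rewrite mulr_ge0.
  by rewrite cE in small; rewrite ge_max; move=> ?; apply/andP; split; lra.
have hq' : Dq <= q * ((1 + n * u) * (u * P) / 2).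
  by apply: (le_trans hq); rewrite ler_wpM2l.
have h1 : (1 + 2 * (n * u)) * Dq
    <= (1 + 2 * (n * u)) * (q * ((1 + n * u) * (u * P) / 2)).
  by rewrite ler_wpM2l //; lra.
have h2 : n * u * (P - 2 * Dq) <= n * u * (T - D) by rewrite ler_wpM2l.
have h3 : (1 + 2 * (n * u)) * (1 + n * u) * (q * (u * P)) <= 2 * (q * (u * P)).
  rewrite ler_wpM2r //; first by rewrite mulr_ge0 // -cE.
  nra.
rewrite cE in hD.
lra.
Qed.

Theorem corollary5 (R : realType) (kind : unperfect_kind)
    (beta mu : nat) (ealpha : int) (n : nat)
    (fl : nat -> R -> R) (y : nat -> R)
    (hbeta : (2 <= beta)%N) (hmu : (1 <= mu)%N) (healpha : ealpha < - mu%:Z)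
    (hn : (1 <= n)%N)
    (hfl : forall k : nat, (1 <= k <= n)%N ->
       rounds_to_nearest (unperfect_system kind beta mu ealpha) (fl k))
    (hu : 20 * n%:R * unit_roundoff R beta mu <= 1) :
  let u := unit_roundoff R beta mu in
  let a := alpha R kind beta mu ealpha in
  let S := \sum_(0 <= k < n.+1) y k in
  let T := \sum_(0 <= k < n.+1) `|y k| in
  `|fl_sum fl y n - S|
     <= n%:R * a / 2 + (n%:R * u) / (1 + n%:R * u) * (n%:R * a / 2 + T)
  /\
  (a <= u * T ->
   `|fl_sum fl y n - S| <= (n%:R * u) / (1 + n%:R * u) * T).
Proof.
move=> u a S T.
have u0 : 0 < u by apply: unit_roundoff_gt0.
have a0 : 0 <= a by apply: alpha_ge0.
have n0 : 0 <= n%:R :> R by [].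
have nu0 : 0 <= n%:R * u by rewrite mulr_ge0 // ltW.
have nu : 20 * (n%:R * u) <= 1 by rewrite mulrA.
have T0 : 0 <= T by apply: sumr_ge0.
have errS := @fl_sum_error_le R fl y n.
have [small|[q [P [qn P0 hq hD hT]]]] := error_profile (y := y) hbeta hfl.
  have {errS}err : `|fl_sum fl y n - S| <= n%:R * (a / 2).
    exact: le_trans errS small.
  split=> [|aT].
    have na0 : 0 <= n%:R * a by rewrite mulr_ge0.
    have : 0 <= n%:R * u / (1 + n%:R * u) * (n%:R * a / 2 + T).
      apply: mulr_ge0; last lra.
      by apply: divr_ge0 => //; lra.
    lra.
  apply: (le_trans err); apply: nu_quotient_le => //.
  have h1 : n%:R * a <= n%:R * (u * T) by rewrite ler_wpM2l.
  have h2 : n%:R * u * (n%:R * a) <= 1 * (n%:R * a).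
    by rewrite ler_wpM2r ?mulr_ge0 //; lra.
  lra.
have qn' : 0 <= (q%:R : R) <= n%:R by rewrite ler0n ler_nat.
split=> [|aT]; apply: (le_trans errS).
- by apply: absolute_arith hq hD hT => //; [exact: ltW|exact: ltW|lra].
- by apply: relative_arith hq hD hT aT => //; exact: ltW.
Qed.
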